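(* Let $p$ be a prime number and let $S$ be an association scheme on $X$ such that (i) $\mathbf{O}^{\theta}(S)\simeq C_p\times C_p$; (ii) $\{n_s\mid s\in S\setminus\mathbf{O}^{\theta}(S)\}=\{p\}$; (iii) $s_1s_1^*\ne s_2s_2^*$ for all $s_1,s_2\in S\setminus\mathbf{O}^{\theta}(S)$ with $s_1\mathbf{O}^{\theta}(S)\ne s_2\mathbf{O}^{\theta}(S)$; and (iv) $\delta(S)=n_S/n_{\mathbf{O}^{\theta}(S)}=p+2$ is an odd prime. Then $S$ is non-schurian.
   Context: An association scheme on a non-empty set $X$ is a partition $S$ of $X\times X$ such that (1) $1_X=\{(x,x)\mid x\in X\}\in S$; (2) for each $s\in S$, $s^*=\{(x,y)\mid (y,x)\in s\}\in S$; (3) for all $s,t,u\in S$, the number $c_{st}^u=|xs\cap yt^*|$ is the same for all $(x,y)\in u$, where $xs=\{y\in X\mid (x,y)\in s\}$. The valency of $s$ is the positive integer $n_s=c_{ss^*}^{1_X}$; for $U\subseteq S$ put $n_U=\sum_{u\in U}n_u$; $n_S$ is the (finite) order of $S$. For nonempty $P,Q\subseteq S$, the complex product $PQ$ is the set of $s\in S$ with $c_{pq}^s\ne 0$ for some $p\in P$, $q\in Q$ (singletons $\{s\}$ are written $s$, so $ss^*$ and $s\mathbf{O}^{\theta}(S)$ are subsets of $S$). A subset $T\subseteq S$ is closed if $\bigcup_{t\in T}t$ is an equivalence relation on $X$; it is strongly normal if moreover $s^*Ts\subseteq T$ for every $s\in S$. The thin residue $\mathbf{O}^{\theta}(S)$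 is the intersection of all strongly normal closed subsets of $S$. A closed subset $T$ is thin if all its elements have valency $1$; then it is a group under the relational product. The condition $\mathbf{O}^{\theta}(S)\simeq C_p\times C_p$ means that $\mathbf{O}^{\theta}(S)$ is thin and, as a group, isomorphic to $C_p\times C_p$. A scheme $S$ on $X$ is schurian if there is a transitive permutation group $G$ on $X$ such that $S$ is the set of orbits of the induced action of $G$ on $X\times X$; otherwise it is non-schurian. *)

(* Defs.v *)
From HB Require Import structures.
From mathcomp Require Import all_boot all_order all_fingroup all_algebra.

Set Implicit Arguments.
Unset Strict Implicit.
Unset Printing Implicit Defensive.

(* A relation on the finite set X is a value of type {set X * X}. *)
Section Relations.
Variable X : finType.
Implicit Types (s t u : {set X * X}) (x y : X).

Definition diag_rel : {set X * X} := [set (x, x) | x : X].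

Definition conv_rel s : {set X * X} := [set z | (z.2, z.1) \in s].

Definition comp_rel s t : {set X * X} :=
  [set z | [exists y, ((z.1, y) \in s) && ((y, z.2) \in t)]].

Definition nbh x s : {set X} := [set y | (x, y) \in s].

Definition paths_card s t x y : nat := #|nbh x s :&: nbh y (conv_rel t)|.

(* c_{st}^u, read off at an arbitrary pair of u; for relations of a scheme the
   value does not depend on that pair, and u is never empty. *)
Definition struct_const s t u : nat :=
  if [pick z in u] is Some z then paths_card s t z.1 z.2 else 0.

Definition valency s : nat := struct_const s (conv_rel s) diag_rel.

Definition set_valency (U : {set {set X * X}}) : nat := \sum_(u in U) valency u.

End Relations.

Section Schemes.
Variables (X : finType) (S : {set {set X * X}}).
Implicit Types (T P Q : {set {set X * X}}) (s : {set X * X}).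

Definition association_scheme : Prop :=
  [/\ 0 < #|X|,
      partition S [set: X * X],
      diag_rel X \in S,
      forall s, s \in S -> conv_rel s \in S
    & forall s t u, s \in S -> t \in S -> u \in S ->
        forall z w, z \in u -> w \in u ->
          paths_card s t z.1 z.2 = paths_card s t w.1 w.2].

Definition complex_prod P Q : {set {set X * X}} :=
  [set s in S | [exists p in P, exists q in Q, struct_const p q s != 0]].

Definition closed_subset T : bool :=
  [&& T \subset S,
      [forall x, (x, x) \in cover T],
      [forall x, forall y, ((x, y) \in cover T) ==> ((y, x) \in cover T)]
    & [forall x, forall y, forall z,
        ((x, y) \in cover T) && ((y, z) \in cover T) ==> ((x, z) \in cover T)]].

Definition strongly_normal T : bool :=
  closed_subset T &&
  [forall s in S,
    complex_prod (complex_prod [set conv_rel s] T) [set s] \subset T].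

Definition thin_residue : {set {set X * X}} :=
  \bigcap_(T : {set {set X * X}} | strongly_normal T) T.

Definition thin T : bool := closed_subset T && [forall s in T, valency s == 1].

(* A thin closed subset is a group under comp_rel only relative to the scheme
   axioms, so the isomorphism is an explicit bijection G -> T rather than isog. *)
Definition thin_isog T (gT : finGroupType) (G : {group gT}) : Prop :=
  thin T /\
  exists f : gT -> {set X * X},
    [/\ {in G &, injective f},
        f @: G = T
      & {in G &, forall a b, f (a * b)%g = comp_rel (f a) (f b)}].

Definition delta : rat :=
  ((set_valency S)%:R / (set_valency thin_residue)%:R)%R.

End Schemes.

Section Schurian.
Variable X : finType.

Definition pair_aperm (z : X * X) (a : {perm X}) : X * X := (a z.1, a z.2).

Lemma pair_aperm_is_action : is_action [set: {perm X}] pair_aperm.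
Proof.
split=> [a [x y] [x' y'] [/perm_inj -> /perm_inj ->] // | [x y] a b _ _].
by rewrite /pair_aperm /= !permM.
Qed.

Definition pair_action : action [set: {perm X}] (X * X)%type :=
  Action pair_aperm_is_action.

Definition schurian (S : {set {set X * X}}) : Prop :=
  exists2 G : {group {perm X}},
    [transitive G, on [set: X] | 'P] &
    S = [set orbit pair_action G z | z : X * X].

End Schurian.

(* Main.v *)
(* Suppose S is the set of orbitals of a transitive group G. Since the thin
   residue T is thin and strongly normal, a point stabiliser G_x fixes the
   T-class of x pointwise and maps every T-class to itself. If x, y, z lie in
   different classes and g in G_x :&: G_y moves z, then both z^(G_x) and
   z^(G_y), being suborbits of prime length p, coincide with z^<g>, which (iii)
   forbids. So the two-point stabilisers of points in different classes are
   trivial, |G_x| = p and |G| = p^3 (p + 2). By Sylow's theorem G has a normal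
   subgroup Q of order p + 2, and G_x, of order p, centralises it because
   |Aut Q| = p + 1. Hence Q acts on the set of fixed points of G_x, which is
   the class of x and has p^2 points; so Q fixes a point, whose stabiliser has
   only p elements. *)

Require Import Defs.
From HB Require Import structures.
From mathcomp Require Import all_boot all_order all_fingroup all_algebra.
From mathcomp Require Import all_solvable.
From mathcomp Require Import zify.

Local Open Scope group_scope.

(** * Sylow theory in groups of order p^3 (p + 2) *)

Lemma prime_cent_subgroup (gT : finGroupType) (G H : {group gT}) (p : nat) :
    prime p -> prime (p + 2) -> odd p -> #|G| = (p ^ 3 * (p + 2))%N ->
    H \subset G -> #|H| = p ->
  exists2 Q : {group gT}, Q \subset G & #|Q| = (p + 2)%N /\ Q \subset 'C(H).
Proof.
move=> p_pr q_pr p_odd oG sHG oH.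
have p_gt2 : (2 < p)%N by case: p p_pr p_odd {q_pr oG oH} => [|[|[|]]].
have [Q sylQ] := Sylow_exists (p + 2) G.
have co_pq : coprime (p + 2) p.
  by rewrite prime_coprime // dvdn_prime2 //; lia.
have oQ : #|Q| = (p + 2)%N.
  rewrite (card_Hall sylQ) oG partnM ?expn_gt0 ?prime_gt0 //.
  rewrite [X in (X * _)%N]part_p'nat ?part_pnat_id ?pnat_id ?mul1n //.
  by rewrite p'natE // Euclid_dvdX // negb_and -prime_coprime ?co_pq.
have sQG := pHall_sub sylQ.
have nQG : Q <| G.
  (* Since [Q] lies in its normaliser, the index of ['N_G(Q)] divides the index p^3 of [Q]. *)
  have nSyl : (#|'Syl_(p + 2)(G)| %| p ^ 3)%N.
    have iGQ : #|G : Q| = (p ^ 3)%N by rewrite -divgS // oG oQ mulnK ?addn2.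
    rewrite (card_Syl sylQ) -iGQ -(@Lagrange_index _ G 'N_G(Q) Q) ?subsetIl //.
      exact: dvdn_mulr.
    by rewrite subsetI sQG normG.
  have := card_Syl_mod G q_pr.
  case/dvdn_pfactor: nSyl => // k k_le3 nSyl.
  have [k0|k_gt0] := posnP k.
    move=> _; have : #|G : 'N_G(Q)| == 1%N by rewrite -(card_Syl sylQ) nSyl k0.
    rewrite indexg_eq1 => sGN; rewrite /normal sQG.
    exact: subset_trans sGN (subsetIr _ _).
  have pk_gt0 : (0 < p ^ k)%N by rewrite expn_gt0 prime_gt0.
  have q1 : (1 %% (p + 2) = 1)%N by rewrite modn_small ?addn2.
  rewrite nSyl -[in RHS]q1 => /eqP; rewrite eqn_mod_dvd //.
  (* p + 2 divides none of p - 1, p^2 - 1 and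
     p^3 - 1 = (p - 1)((p + 2)(p - 1) + 3). *)
  case: k k_gt0 k_le3 {nSyl pk_gt0} => [|[|[|[|]]]] // _ _.
  - by rewrite expn1 => /dvdn_leq; lia.
  - rewrite -[1%N](exp1n 2) subn_sqr Euclid_dvdM //.
    by case/orP=> /dvdn_leq; lia.
  have -> : (p ^ 3 - 1 = (p - 1) * ((p + 2) * (p - 1) + 3))%N by nia.
  rewrite Euclid_dvdM // dvdn_addr ?dvdn_mulr //.
  by case/orP=> /dvdn_leq; lia.
(* The kernel of [conj_aut Q] is the centraliser of [Q], so it suffices that the image of [H] be
   trivial; its order divides both p + 1 and p. *)
exists Q => //; split=> //; rewrite centsC -(ker_conj_aut Q).
have nQH : H \subset 'N(Q) := subset_trans sHG (normal_norm nQG).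
rewrite ker_trivg_morphim nQH /=.
have oA : (#|conj_aut Q @* H| %| p.+1)%N.
  have -> : p.+1 = #|Aut Q|.
    rewrite card_Aut_cyclic ?prime_cyclic ?oQ // totient_prime //; lia.
  exact: cardSg (Aut_conj_aut _ _).
have oB : (#|conj_aut Q @* H| %| p)%N by rewrite -oH dvdn_morphim.
rewrite subG1 trivg_card_le1.
have : (#|conj_aut Q @* H| %| 1)%N by rewrite -(dvdn_addr 1 oB) addn1.
by rewrite dvdn1 => /eqP->.
Qed.

(** * Suborbits and point stabilisers of a permutation group *)

Section PermutationGroup.

(** [E] stands for lying in one class of the thin residue; [suborbits_neq] is what hypothesis (iii)
    becomes in terms of points. *)
Variables (X : finType) (G : {group {perm X}}) (E : rel X) (p : nat).
Hypothesis E_sym : symmetric E.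
Hypothesis fix_class :
  forall x y g, g \in 'C_G[x | 'P] -> E x y -> g y = y.
Hypothesis stab_class : forall x y g, g \in 'C_G[x | 'P] -> E y (g y).
Hypothesis p_prime : prime p.
Hypothesis card_suborbit :
  forall x y, ~~ E x y -> #|orbit 'P 'C_G[x | 'P] y| = p.
Hypothesis suborbits_neq : forall x y z,
  ~~ E x y -> ~~ E x z -> ~~ E y z ->
  orbit 'P 'C_G[x | 'P] z <> orbit 'P 'C_G[y | 'P] z.

(** The stabiliser of z in G_x has prime index p and is normalised by g, which lies outside it; so
    the two together give all of G_x. The gain is a right-hand side that does not mention x. *)
Lemma suborbit_cycle x z g :
    ~~ E x z -> g \in 'C_G[x | 'P] -> g z != z ->
  orbit 'P 'C_G[x | 'P] z = orbit 'P <[g]> z.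
Proof.
move=> nExz gC gz.
set C := 'C_G[x | 'P]%G; set D := 'C_C[z | 'P]%G.
have gG : g \in G by case/setIP: gC.
have iD : #|C : D| = p by rewrite -card_orbit card_suborbit.
(* D fixes the class of z pointwise, so it is the stabiliser in C of every
   point of that class. *)
have gND : <[g]> \subset 'N(D).
  rewrite cycle_subG; apply/normP/eqP; rewrite eqEcard cardJg leqnn andbT.
  apply/subsetP=> _ /imsetP[d dD ->]; have /setIP[dC /astab1P dz] := dD.
  have djC : d ^ g \in C by rewrite groupJ.
  rewrite inE djC; apply/astab1P => /=.
  have djG : d ^ g \in G by case/setIP: djC.
  apply: (@fix_class (g z)); last by rewrite E_sym (stab_class _ _ _ gC).
  rewrite inE djG; apply/astab1P; rewrite /= /aperm.
  by rewrite permJ; congr (g _).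
have defC : D * <[g]> = C.
  rewrite -norm_joinEr //; apply/eqP; rewrite eqEsubset.
  rewrite join_subG subsetIl cycle_subG gC /=.
  have sDM : D \subset (D <*> <[g]>) by apply: joing_subl.
  have sMC : D <*> <[g]> \subset C by rewrite join_subG subsetIl cycle_subG gC.
  rewrite -indexg_eq1.
  have := Lagrange_index sMC sDM; rewrite iD => iCM.
  have : (#|C : D <*> <[g]>| %| p)%N by rewrite -iCM dvdn_mulr.
  (* The index of [D <*> <[g]>] in [C] is 1 or p; if it were p, then g would lie in [D] and fix
     z. *)
  have /primeP[_ dvp] := p_prime; case/dvp/orP=> [//|/eqP iCMp].
  have : D <*> <[g]> \subset D.
    by rewrite -indexg_eq1 -(eqn_pmul2l (prime_gt0 p_prime)) -{1}iCMp iCM muln1.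
  rewrite join_subG => /andP[_]; rewrite cycle_subG => /setIP[_].
  by move/astab1P => /= gz1; rewrite /aperm in gz1; rewrite gz1 eqxx in gz.
apply/eqP; rewrite eqEsubset; apply/andP; split; apply/subsetP=> w.
  case/orbitP=> a; rewrite -[a \in _]/(a \in gval C) -defC => /mulsgP[d h].
  move=> /setIP[_ /astab1P dz] hg -> <-.
  by rewrite actM dz; apply: mem_orbit.
case/orbitP=> a ag <-; apply: mem_orbit.
by apply: (subsetP _ a ag); rewrite cycle_subG.
Qed.

Lemma biclass_stab_fix x y z :
    ~~ E x y -> ~~ E x z -> ~~ E y z ->
  'C_G[x | 'P] :&: 'C_G[y | 'P] \subset 'C[z | 'P].
Proof.
move=> nxy nxz nyz; apply/subsetP=> g /setIP[gx gy].
apply/astab1P; apply/eqP; apply: contraT => gz.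
case: (suborbits_neq _ _ _ nxy nxz nyz).
by rewrite (suborbit_cycle _ _ _ nxz gx gz) (suborbit_cycle _ _ _ nyz gy gz).
Qed.

(** By orbit-stabiliser it suffices that only 1 fixes both x and y: [fix_class] handles the classes
    of x and y, [biclass_stab_fix] all other points. *)
Lemma card_stab x y : ~~ E x y -> #|'C_G[x | 'P]| = p.
Proof.
move=> nxy; rewrite -(card_suborbit _ _ nxy) card_orbit -indexg1.
congr #|_ : _|; apply/esym/trivgP/subsetP=> g /setIP[gx gy'].
have gy : g \in 'C_G[y | 'P] by case/setIP: gx => gG _; apply/setIP.
apply/set1P/permP=> z; rewrite perm1.
have [Exz|nxz] := boolP (E x z); first exact: fix_class gx Exz.
have [Eyz|nyz] := boolP (E y z); first exact: fix_class gy Eyz.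
have /astab1P // : g \in 'C[z | 'P].
by apply: (subsetP (biclass_stab_fix _ _ _ nxy nxz nyz)); rewrite inE gx.
Qed.

Hypothesis G_trans : [transitive G, on [set: X] | 'P].
Hypothesis card_class : forall x, #|[set y | E x y]| = (p ^ 2)%N.
Hypothesis cardX : #|X| = (p ^ 2 * (p + 2))%N.
Hypothesis q_prime : prime (p + 2).
Hypothesis p_odd : odd p.

Lemma no_prime_suborbit_group : False.
Proof.
have p_gt0 := prime_gt0 p_prime.
have q_gt1 := prime_gt1 q_prime.
(* A class has p^2 points, fewer than [X], so [card_stab] will apply at every point. *)
have outside x : exists y, ~~ E x y.
  apply/existsP; apply: contraT; rewrite negb_exists => /forallP allE.
  have : (#|[set y | E x y]| = #|X|)%N.
    rewrite -cardsT; apply: eq_card => y; rewrite !inE.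
    by have := allE y; rewrite negbK => ->.
  rewrite card_class cardX -{1}[(p ^ 2)%N]muln1 => /eqP.
  by rewrite eqn_pmul2l ?expn_gt0 ?p_gt0 //; lia.
have oC x : #|'C_G[x | 'P]| = p by have [y /card_stab] := outside x.
have /card_gt0P[x _] : (0 < #|X|)%N.
  by rewrite cardX muln_gt0 expn_gt0 p_gt0 addn2.
have oG : #|G| = (p ^ 3 * (p + 2))%N.
  have := card_orbit 'P G x; rewrite (atransP G_trans) ?inE // cardsT cardX.
  move=> iG; rewrite -(Lagrange (subsetIl G 'C[x | 'P])) -iG oC.
  by rewrite mulnA -expnS.
set H := 'C_G[x | 'P]%G.
have [Q sQG [oQ cHQ]] :=
  @prime_cent_subgroup _ G H p p_prime q_prime p_odd oG (subsetIl _ _) (oC x).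
(* A point outside the class of x has a suborbit of p > 1 points, so [H] moves it. *)
have fixH : 'Fix_('P)(H) = [set y | E x y].
  apply/setP=> y; rewrite inE; apply/afixP/idP => [fixy|Exy g gH].
    apply: contraT => nxy; have := card_suborbit _ _ nxy.
    rewrite (_ : orbit _ _ _ = [set y]) ?cards1.
      by move=> p1; move: p_prime; rewrite -p1.
    apply/setP=> w; rewrite inE; apply/orbitP/eqP=> [[g gH <-]|->].
      exact: fixy.
    by exists 1; rewrite ?group1 ?act1.
  exact: fix_class gH Exy.
have actQ : [acts Q, on 'Fix_('P)(H) | 'P].
  exact/acts_fix_norm/(subset_trans cHQ (cent_sub _)).
have qQ : (p + 2).-group Q by rewrite /pgroup oQ pnat_id.
have := pgroup_fix_mod qQ actQ; rewrite fixH card_class => fixQ.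
(* Without a fixed point, p + 2 would divide p^2. *)
have : 'Fix_([set y | E x y] | 'P)(Q) != set0.
  apply: contra_eqN fixQ => /eqP->; rewrite cards0 mod0n -/(dvdn _ _).
  rewrite Euclid_dvdX // andbT dvdn_prime2 //; lia.
case/set0Pn=> y /setIP[_ /afixP fixy].
have sQy : Q \subset 'C_G[y | 'P].
  by rewrite subsetI sQG; apply/subsetP=> g /fixy gy; apply/astab1P.
have := subset_leq_card sQy; rewrite oQ oC; lia.
Qed.

End PermutationGroup.

(** * Association schemes in terms of points *)

Section Scheme.

Variables (X : finType) (S : {set {set X * X}}).
Hypothesis schemeS : association_scheme S.

Lemma scheme_rel z : exists2 s, s \in S & z \in s.
Proof.
case: schemeS => _ /and3P[/eqP covS _ _] _ _ _.
by have : z \in cover S by [rewrite covS]; case/bigcupP=> s; exists s.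
Qed.

Lemma scheme_rel_uniq s t z : s \in S -> t \in S -> z \in s -> z \in t -> s = t.
Proof.
case: schemeS => _ /and3P[_ trivS _] _ _ _ sS tS zs zt.
by rewrite -(def_pblock trivS sS zs) (def_pblock trivS tS zt).
Qed.

Lemma scheme_rel_neq0 s : s \in S -> exists z, z \in s.
Proof.
case: schemeS => _ /and3P[_ _ s0] _ _ _ sS.
by apply/set0Pn; apply: contraNneq s0 => <-.
Qed.

Lemma mem_coverE (P : {set {set X * X}}) s z :
  P \subset S -> s \in S -> z \in s -> (z \in cover P) = (s \in P).
Proof.
move=> sPS sS zs; apply/bigcupP/idP=> [[t tP zt]|sP]; last by exists s.
by rewrite (scheme_rel_uniq s t z) // (subsetP sPS).
Qed.

Lemma struct_constE s t u x y :
  s \in S -> t \in S -> u \in S -> (x, y) \in u ->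
  struct_const s t u = paths_card s t x y.
Proof.
case: schemeS => _ _ _ _ regS sS tS uS xyu; rewrite /struct_const.
case: pickP => [z zu|/(_ (x, y))]; last by rewrite xyu.
exact: (regS s t u sS tS uS z (x, y)).
Qed.

Lemma valencyE s x : s \in S -> valency s = #|nbh x s|.
Proof.
case: schemeS => _ _ diagS convS _ sS; rewrite /valency.
rewrite (struct_constE _ _ _ x x) ?convS //; last exact: imset_f.
by rewrite /paths_card; congr #|pred_of_set _|; apply/setP=> y; rewrite !inE andbb.
Qed.

(** Structure constants do not depend on the chosen pair, so a path through w between the ends of
    any one pair of s decides membership. *)
Lemma complex_prodP (P Q : {set {set X * X}}) s x y :
    P \subset S -> Q \subset S -> s \in S -> (x, y) \in s ->
  reflect (exists w, (x, w) \in cover P /\ (w, y) \in cover Q)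
          (s \in complex_prod S P Q).
Proof.
move=> sPS sQS sS xys; rewrite inE sS /=.
have constE a b : a \in P -> b \in Q ->
    (struct_const a b s != 0) = [exists w, ((x, w) \in a) && ((w, y) \in b)].
  move=> aP bQ; have [aS bS] := (subsetP sPS a aP, subsetP sQS b bQ).
  rewrite (struct_constE _ _ _ x y) // /paths_card cards_eq0.
  by apply/set0Pn/existsP => -[w]; rewrite ?inE => wab; exists w; rewrite ?inE.
apply: (iffP 'exists_in_existsP).
  case=> a aP [b /andP[bQ]].
  rewrite constE // => /existsP[w /andP[xa by_]].
  by exists w; split; apply/bigcupP; [exists a|exists b].
case=> w [/bigcupP[a aP xa] /bigcupP[b bQ by_]].
exists a => //; exists b; rewrite bQ constE //.
by apply/existsP; exists w; rewrite xa.
Qed.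

(** Double counting: each y is joined to x by exactly one relation of [S]. *)
Lemma set_valencyE (P : {set {set X * X}}) x :
  P \subset S -> set_valency P = #|[set y | (x, y) \in cover P]|.
Proof.
move=> sPS; rewrite -sum1_card big_mkcond /set_valency.
rewrite (eq_bigr (fun s : {set X * X} => \sum_y ((x, y) \in s))%N); last first.
  move=> s /(subsetP sPS) sS; rewrite (valencyE _ x) // -sum1_card big_mkcond.
  by apply: eq_bigr => y _; rewrite inE; case: ifP.
rewrite exchange_big; apply: eq_bigr => y _; rewrite inE.
have [s sS xys] := scheme_rel (x, y); rewrite (mem_coverE _ _ _ sPS sS xys).
have other t : t \in P -> t != s -> ((x, y) \in t : nat) = 0%N.
  move=> tP nts; apply/eqP; rewrite eqb0; apply: contra nts => xyt.
  by rewrite (scheme_rel_uniq t s (x, y)) // (subsetP sPS).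
case: ifP => sP; last first.
  by rewrite big1 // => t tP; apply: other => //; apply: contraFneq sP => <-.
rewrite (bigD1 s) //= xys big1 // => t /andP[tP nts]; exact: other.
Qed.

(** The path x, w, w, y puts the relation of (x, y) into the product of s^*, [T] and s. *)
Lemma strongly_normal_cover (T : {set {set X * X}}) s w x y :
    strongly_normal S T -> s \in S -> (w, x) \in s -> (w, y) \in s ->
  (x, y) \in cover T.
Proof.
case/andP=> /and4P[sTS /forallP reflT _ _] /forall_inP normT sS wx wy.
have convS : conv_rel s \in S by case: schemeS => _ _ _ /(_ s sS).
have [t tS xyt] := scheme_rel (x, y).
rewrite (mem_coverE _ _ _ sTS tS xyt); apply: (subsetP (normT s sS)).
have xw : (x, w) \in conv_rel s by rewrite inE.
have conv_prod : conv_rel s \in complex_prod S [set conv_rel s] T.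
  apply/(complex_prodP _ _ _ x w); rewrite ?sub1set //.
  by exists w; rewrite reflT cover1.
apply/(complex_prodP _ _ _ x y); rewrite ?sub1set //.
  by apply/subsetP=> u; rewrite inE => /andP[].
by exists w; rewrite cover1; split=> //; apply/bigcupP; exists (conv_rel s).
Qed.

(** Relations are disjoint, so the same t through (x, y) lies in every strongly normal [T], hence in
    their intersection. *)
Lemma thin_residue_cover s w x y :
    thin_residue S \subset S -> s \in S -> (w, x) \in s -> (w, y) \in s ->
  (x, y) \in cover (thin_residue S).
Proof.
move=> sRS sS wx wy; have [t tS xyt] := scheme_rel (x, y).
rewrite (mem_coverE _ _ _ sRS tS xyt); apply/bigcapP=> T snT.
have /andP[/and4P[sTS _ _ _] _] := snT.
by rewrite -(mem_coverE _ _ _ sTS tS xyt) (strongly_normal_cover _ _ w x y snT sS).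
Qed.

End Scheme.

(** * Schemes formed by the orbitals of a group *)

Section Orbitals.

Variables (X : finType) (S : {set {set X * X}}) (G : {group {perm X}}).
Hypothesis schemeS : association_scheme S.
Hypothesis S_orbitals : S = [set orbit (@pair_action X) G z | z : X * X].

Lemma orbital_eq s z : s \in S -> z \in s -> s = orbit (@pair_action X) G z.
Proof.
rewrite S_orbitals => /imsetP[w _ ->] zw.
by apply/esym/orbit_in_eqP => //; apply: subsetT.
Qed.

Lemma orbital_perm s x y g :
  s \in S -> g \in G -> (x, y) \in s -> (g x, g y) \in s.
Proof.
move=> sS gG xys; rewrite (orbital_eq _ _ sS xys).
by apply/orbitP; exists g.
Qed.

Lemma nbh_orbital s x y :
  s \in S -> (x, y) \in s -> nbh x s = orbit 'P 'C_G[x | 'P] y.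
Proof.
move=> sS xys; apply/setP=> w; rewrite inE; apply/idP/orbitP=> [|[g]].
  rewrite {1}(orbital_eq _ _ sS xys) => /orbitP[g gG [gx gy]].
  by exists g => //; rewrite inE gG; apply/astab1P.
case/setIP=> gG /astab1P gx <-.
have := orbital_perm _ _ _ _ sS gG xys.
by rewrite /= /aperm in gx *; rewrite gx.
Qed.

(** Shows that the suborbit of z under G_x determines the product of s and s^*, which brings (iii)
    to bear on suborbits. *)
Lemma mem_complex_prod_conv s t x z :
    [transitive G, on [set: X] | 'P] -> thin_residue S \subset S ->
    (forall y g, g \in 'C_G[z | 'P] -> (z, y) \in cover (thin_residue S) ->
       g y = y) ->
    s \in S -> t \in S -> (z, x) \in s ->
  (t \in complex_prod S [set s] [set conv_rel s])
    = [exists w in orbit 'P 'C_G[x | 'P] z, (z, w) \in t].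
Proof.
move=> transG sRS fix_z sS tS zxs.
have convS : conv_rel s \in S by case: schemeS => _ _ _ /(_ s sS).
have xz : (x, z) \in conv_rel s by rewrite inE.
rewrite -(nbh_orbital _ _ _ convS xz); apply/idP/exists_inP; last first.
  case=> w; rewrite inE => xw zwt.
  apply/(complex_prodP _ _ schemeS _ _ _ z w); rewrite ?sub1set //.
  by exists x; rewrite !cover1.
move=> t_prod; have [[a b] abt] := scheme_rel_neq0 _ _ schemeS t tS.
have /orbitP[g gG gaz] : z \in orbit 'P G a by rewrite (atransP transG) ?inE.
have /(orbital_perm _ _ _ _ tS) : g \in G by [].
move/(_ _ _ abt); rewrite /= /aperm in gaz; rewrite gaz => zbt.
exists (g b) => //; rewrite inE.
have := complex_prodP _ _ schemeS [set s] [set conv_rel s] t z (g b).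
rewrite !sub1set => /(_ sS convS tS zbt t_prod) [w []]; rewrite !cover1 => zw wb.
(* The intermediate point w is the image of x under some h in G_z. As h fixes [g b], which lies in
   the class of z, applying the inverse of h replaces w by x. *)
have := zw; rewrite {1}(orbital_eq _ _ sS zxs) => /orbitP[h hG [hz hx]].
have hC : h \in 'C_G[z | 'P] by rewrite inE hG; apply/astab1P.
have Ezb : (z, g b) \in cover (thin_residue S).
  by apply: (thin_residue_cover _ _ schemeS _ w) sRS convS _ wb; rewrite inE.
have hb := fix_z _ _ hC Ezb.
move: wb; rewrite -hx inE /= -{1}hb inE /=.
move/(orbital_perm _ _ _ _ sS (groupVr hG)).
by rewrite !permK.
Qed.

End Orbitals.

Theorem theorem3p4 (p : nat) (X : finType) (S : {set {set X * X}})
  (p_prime : prime p)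
  (schemeS : association_scheme S)
  (residue_CpCp : thin_isog S (thin_residue S) (setX (Zp p) (Zp p))%G)
  (valencies : [seq valency s | s in S :\: thin_residue S] =i [:: p])
  (distinct_ss : forall s1 s2 : {set X * X},
     s1 \in S :\: thin_residue S -> s2 \in S :\: thin_residue S ->
     complex_prod S [set s1] (thin_residue S)
       <> complex_prod S [set s2] (thin_residue S) ->
     complex_prod S [set s1] [set conv_rel s1]
       <> complex_prod S [set s2] [set conv_rel s2])
  (deltaE : delta S = ((p + 2)%N%:R)%R)
  (p2_prime : prime (p + 2))
  (p2_odd : odd (p + 2)) :
  ~ schurian S.
Proof.
case=> G transG S_orbitals.
case: residue_CpCp => /andP[closedT /forall_inP val1] [f [inj_f imf _]].
set T := thin_residue S in closedT val1 imf valencies distinct_ss *.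
have /and4P[sTS /forallP reflT /forallP symT /forallP transT] := closedT.
pose E x y := (x, y) \in cover T.
have p_odd : odd p by rewrite oddD addbF in p2_odd.
have E_sym : symmetric E.
  have imp x y : E x y -> E y x by move/forallP/(_ y)/implyP: (symT x).
  by move=> x y; apply/idP/idP; apply: imp.
have fix_class x y g : g \in 'C_G[x | 'P] -> E x y -> g y = y.
  move=> gC /bigcupP[t tT xyt]; have tS := subsetP sTS t tT.
  (* Valency 1 makes the suborbit of y a single point. *)
  have := val1 t tT; rewrite (valencyE _ _ schemeS _ x) //.
  rewrite (nbh_orbital _ _ _ S_orbitals _ _ _ tS xyt) => /eqP /card_orbit1 orb1.
  by apply/set1P; rewrite -orb1; apply/orbitP; exists g.
have stab_class x y g : g \in 'C_G[x | 'P] -> E y (g y).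
  case/setIP=> gG /astab1P /= gx; rewrite /aperm in gx.
  have [s sS xys] := scheme_rel _ _ schemeS (x, y).
  apply: (thin_residue_cover _ _ schemeS s x _ _ sTS sS xys).
  by rewrite -{1}gx; exact: (orbital_perm _ _ _ S_orbitals _ _ _ _ sS gG xys).
have suborbit x y : ~~ E x y -> #|orbit 'P 'C_G[x | 'P] y| = p.
  move=> nxy; have [s sS xys] := scheme_rel _ _ schemeS (x, y).
  rewrite -(nbh_orbital _ _ _ S_orbitals _ _ _ sS xys) -(valencyE _ _ schemeS) //.
  apply/eqP; rewrite -mem_seq1 -valencies; apply: image_f.
  by rewrite inE sS -(mem_coverE _ _ schemeS _ _ _ sTS sS xys) nxy.
have suborbits_neq x y z : ~~ E x y -> ~~ E x z -> ~~ E y z ->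
  orbit 'P 'C_G[x | 'P] z <> orbit 'P 'C_G[y | 'P] z.
  move=> nxy nxz nyz eq_orb.
  have [s1 s1S zx] := scheme_rel _ _ schemeS (z, x).
  have [s2 s2S zy] := scheme_rel _ _ schemeS (z, y).
  have notT s w : s \in S -> (z, w) \in s -> ~~ E w z -> s \in S :\: T.
    move=> sS zw; rewrite inE sS andbT; apply: contra => sT.
    by rewrite E_sym; apply/bigcupP; exists s.
  case: (distinct_ss s1 s2); first exact: notT zx nxz.
  - exact: notT zy nyz.
  (* Equal products would put s1 into the product of s2 and [T], giving w in the class of x with (z,
     w) in s2. Then w is an image of y under G_z, hence in the class of y, against [nxy]. *)
  - move=> eqT; have : s1 \in complex_prod S [set s1] T.
      apply/(complex_prodP _ _ schemeS _ _ _ z x); rewrite ?sub1set //.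
      by exists x; rewrite cover1 reflT.
    rewrite eqT; move/(complex_prodP _ _ schemeS [set s2] T s1 z x).
    rewrite sub1set => /(_ s2S sTS s1S zx) [w]; rewrite cover1 => -[zw wx].
    have := zw; rewrite {1}(orbital_eq _ _ _ S_orbitals _ _ s2S zy).
    case/orbitP=> g gG [gz gy].
    have gC : g \in 'C_G[z | 'P] by rewrite inE gG; apply/astab1P.
    have Eyw : E y w by rewrite -[w]gy; apply: stab_class gC.
    have /forallP/(_ w)/forallP/(_ x)/implyP Eyx := transT y.
    by move: nxy; rewrite E_sym /E Eyx // wx andbT.
  (* Both products are read off from the same suborbit of z. *)
  - apply/setP=> t; have [tS|] := boolP (t \in S); last first.
      by move/negPf=> ntS; rewrite !inE ntS.
    rewrite (mem_complex_prod_conv _ _ _ schemeS S_orbitals s1 t x z) //.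
    rewrite (mem_complex_prod_conv _ _ _ schemeS S_orbitals s2 t y z) ?eq_orb //.
    - by move=> w g; apply: fix_class.
    by move=> w g; apply: fix_class.
have vT : set_valency T = (p ^ 2)%N.
  rewrite /set_valency (eq_bigr (fun=> 1%N)) => [|t tT]; last exact/eqP/val1.
  by rewrite sum1_card -imf card_in_imset // cardsX card_Zp ?prime_gt0.
have card_class x : #|[set y | E x y]| = (p ^ 2)%N.
  by rewrite -(set_valencyE _ _ schemeS) ?vT.
have cardX : #|X| = (p ^ 2 * (p + 2))%N.
  have /card_gt0P[x _] : (0 < #|X|)%N by case: schemeS.
  have -> : #|X| = set_valency S.
    rewrite (set_valencyE _ _ schemeS _ x) // -cardsT; apply: eq_card => y.
    rewrite !inE; have [s sS xys] := scheme_rel _ _ schemeS (x, y).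
    by apply/esym/bigcupP; exists s.
  (* [delta] is a rational quotient: clearing its nonzero denominator brings the equation back to
     [nat]. *)
  have p2_neq0 : ((p ^ 2)%:R != 0 :> rat)%R.
    by rewrite Num.Theory.pnatr_eq0 expn_eq0 andbT -lt0n prime_gt0.
  move: deltaE; rewrite /delta -/T vT => /(congr1 ( *%R^~ (p ^ 2)%:R))%R.
  rewrite GRing.divfK // -GRing.natrM => /eqP; rewrite Num.Theory.eqr_nat => /eqP->.
  exact: mulnC.
exact: (no_prime_suborbit_group X G E p).
Qed.
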